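(* Let $\mathcal M$ be the countable MDP with controlled states $s_0$, $c_i$, $t_i$ ($i\ge1$), random states $\rho_i$ ($i\ge 1$) and a random sink state $\perp$, and with the following transitions and rewards: $s_0\to c_1$ and $c_i\to c_{i+1}$ ($i\ge1$) with reward $-1$; $c_i\to\rho_i$ with reward $0$; from $\rho_i$ the successor is $\perp$ with probability $2^{-i}$ and $t_i$ with probability $1-2^{-i}$, where $\rho_i\to t_i$ has reward $0$; $t_{i+1}\to t_i$ ($i\ge1$) and $t_1\to s_0$ with reward $0$; and $\rho_i\to\perp$ and the self-loop $\perp\to\perp$ with reward $-1$. Let $\varphi$ be the event that the $\limsup$ of the sequence of transition rewards seen along the run is $\ge0$. Then $\sup_\sigma\mathcal P_{\mathcal M,s_0,\sigma}(\varphi)=1$ (supremum over all strategies), and every randomized finite-memory strategy $\sigma$ satisfies $\mathcal P_{\mathcal M,s_0,\sigma}(\varphi)=0$.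
   Context: In an MDP the player chooses the successor at controlled states, while at random states the successor is drawn from the given distribution. A history is a finite path ending in a controlled state; a (general) strategy $\sigma$ maps each history ending in $s$ to a probability distribution on the successors of $s$; together with the start state it induces a probability measure $\mathcal P_{\mathcal M,s_0,\sigma}$ on infinite runs from $s_0$. A randomized finite-memory strategy is given by a finite set $\mathsf M$ of memory modes, an initial mode, a function choosing at controlled states a probability distribution over successors depending only on the current state and the current mode, and a function choosing, after each step from $s$ to $s'$ (from controlled or random $s$), a probability distribution over the next mode depending only on the current mode, $s$ and $s'$. *)

(* Defs.v *)
(* MathComp-Analysis. *)
From HB Require Import structures.
From mathcomp Require Import all_boot all_order all_algebra.
From mathcomp Require Import all_classical all_reals all_analysis.
From mathcomp Require Import measurable_realfun.
From mathcomp Require Import lra.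

Set Implicit Arguments.
Unset Strict Implicit.
Unset Printing Implicit Defensive.
Import Order.TTheory GRing.Theory Num.Theory.
Import numFieldNormedType.Exports.
Local Open Scope classical_set_scope.
Local Open Scope ring_scope.

Section Distributions.
Variable R : realType.

Record distr (T : countType) := Distr {
  mass :> T -> R;
  mass_ge0 : forall x, 0 <= mass x;
  mass_sum1 : \esum_(x in [set: T]) (mass x)%:E = 1%E }.

Lemma esum_pred1 (T : countType) (x : T) (p : R) : 0 <= p ->
  \esum_(z in [set: T]) (p * (z == x)%:R)%:E = p%:E.
Proof.
move=> p0; rewrite -(@esum_set1 R T x (fun=> p%:E)) ?lee_fin//.
rewrite [RHS]esum_mkcond; apply: eq_esum => z _.
by rewrite in_set1; case: (z == x); rewrite ?mulr1 ?mulr0.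
Qed.

Lemma esumZl (T : countType) (c : R) (a : T -> R) :
  0 <= c -> (forall x, 0 <= a x) ->
  \esum_(x in [set: T]) (c * a x)%:E = (c%:E * \esum_(x in [set: T]) (a x)%:E)%E.
Proof.
move=> c0 a0; rewrite /esum -ereal_supZl//; last first.
  by apply/set0P; exists (\sum_(x \in set0) (a x)%:E)%E; exists set0.
congr ereal_sup; rewrite image_comp; apply: eq_imagel => A _ /=.
by rewrite ge0_mule_fsumr// => x; rewrite lee_fin.
Qed.

Lemma coin_ge0 (T : countType) (x y : T) (p : R) : 0 <= p <= 1 ->
  forall z, 0 <= p * (z == x)%:R + (1 - p) * (z == y)%:R.
Proof.
by move=> /andP[p0 p1] z; rewrite addr_ge0// mulr_ge0// subr_ge0.
Qed.

Lemma coin_sum1 (T : countType) (x y : T) (p : R) : 0 <= p <= 1 ->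
  \esum_(z in [set: T]) (p * (z == x)%:R + (1 - p) * (z == y)%:R)%:E = 1%E.
Proof.
move=> /andP[p0 p1]; under eq_esum do rewrite EFinD.
rewrite esumD; first last.
- by move=> z _; rewrite lee_fin mulr_ge0// subr_ge0.
- by move=> z _; rewrite lee_fin mulr_ge0.
by rewrite !esum_pred1 ?subr_ge0// -EFinD addrC subrK.
Qed.

(* x with probability p, y with probability 1 - p *)
Definition coin (T : countType) (x y : T) (p : R) (p01 : 0 <= p <= 1) :
  distr T := Distr (coin_ge0 x y p01) (coin_sum1 x y p01).

Lemma one01 : 0 <= (1 : R) <= 1. Proof. by rewrite ler01 lexx. Qed.

Definition point_distr (T : countType) (x : T) : distr T := coin x x one01.

Section Joint.
Variables (T U : countType) (p : distr T) (q : T -> distr U).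

Lemma joint_ge0 (z : T * U) : 0 <= p z.1 * q z.1 z.2.
Proof. by rewrite mulr_ge0 ?mass_ge0. Qed.

Lemma joint_sum1 : \esum_(z in [set: T * U]) (p z.1 * q z.1 z.2)%:E = 1%E.
Proof.
rewrite [X in esum X _](_ : _ = [set: T] `*`` (fun=> [set: U])); last first.
  by apply/seteqP; split.
rewrite -(esum_esum (a := fun x y => (p x * q x y)%:E)); last first.
  by move=> x y _ _; rewrite lee_fin mulr_ge0 ?mass_ge0.
rewrite -(mass_sum1 p); apply: eq_esum => x _.
rewrite esumZl ?mass_ge0//; last exact: mass_ge0.
by rewrite mass_sum1 mule1.
Qed.

(* first draw x from p, then y from q x *)
Definition joint : distr (T * U)%type := Distr joint_ge0 joint_sum1.
End Joint.
End Distributions.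

(* The infinite sequences over T; the start element x0 of the process serves
   only as the default point that measurable spaces are required to have. *)
Definition run (T : countType) (x0 : T) : Type := nat -> T.

HB.instance Definition _ (T : countType) (x0 : T) := Choice.on (run x0).
HB.instance Definition _ (T : countType) (x0 : T) :=
  isPointed.Build (run x0) (fun=> x0).

Section Runs.
Variables (T : countType) (x0 : T).

Definition cylinder (w : seq T) : set (run x0) :=
  [set r | mkseq r (size w) = w].

Definition cylinders : set (set (run x0)) := range cylinder.

Definition runs : measurableType (sigma_display cylinders) :=
  g_sigma_algebraType cylinders.
End Runs.
Arguments cylinder {T} x0 w.
Arguments cylinders {T} x0.
Arguments runs {T} x0.

Section ImageProbability.
Context d1 d2 (T1 : measurableType d1) (T2 : measurableType d2) (R : realType).
Variables (mu : {measure set T1 -> \bar R}) (mu1 : mu setT = 1%E).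
Variables (f : T1 -> T2) (mf : measurable_fun [set: T1] f).

Let law := pushforward mu f.

Let law0 : law set0 = 0%E. Proof. exact: measure0. Qed.

Let law_ge0 A : (0 <= law A)%E. Proof. exact: measure_ge0. Qed.

Let law_sigma_additive : semi_sigma_additive law.
Proof. exact: measure_semi_sigma_additive. Qed.

HB.instance Definition _ := isMeasure.Build _ _ _ law
  law0 law_ge0 law_sigma_additive.

Let law_setT : law setT = 1%E.
Proof. by rewrite /law /pushforward preimage_setT. Qed.

HB.instance Definition _ := Measure_isProbability.Build _ _ _ law law_setT.

Definition image_probability : probability T2 R := law.
End ImageProbability.

Section Trajectory.
Variables (R : realType) (T : countType) (x0 : T).
(* k w : distribution of the next element after the finite sequence w *)
Variable k : seq T -> distr R T.

Definition prefix_prob (w : seq T) : R :=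
  \prod_(i < size w) k (x0 :: take i w) (nth x0 w i).

(* The measure is obtained by splitting [0, 1[ into nested half-open intervals,
   one for each finite sequence w, of length prefix_prob w; a point of [0, 1[
   then determines a sequence, and the Lebesgue measure is pushed forward. *)
Let q (h : seq T) (n : nat) : R :=
  if pickle_inv n is Some x then k h x else 0.
Let F h n : R := \sum_(0 <= j < n) q h j.

Let q_ge0 h n : 0 <= q h n.
Proof. by rewrite /q; case: pickle_inv => // x; exact: mass_ge0. Qed.

Let q_pickle h x : q h (pickle x) = k h x.
Proof. by rewrite /q pickleK_inv. Qed.

Let FS h n : F h n.+1 = F h n + q h n.
Proof. by rewrite /F big_nat_recr. Qed.

Let F_homo h m n : (m <= n)%N -> F h m <= F h n.
Proof.
move=> mn; rewrite /F [leRHS](@big_cat_nat _ _ _ m)//= lerDl.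
by apply: sumr_ge0 => i _; exact: q_ge0.
Qed.

Let F_ge0 h n : 0 <= F h n.
Proof. by apply: sumr_ge0 => i _; exact: q_ge0. Qed.

Let q_sum1 h : (\sum_(n <oo) (q h n)%:E = 1)%E.
Proof.
rewrite nneseries_esumT; last by move=> n; rewrite lee_fin.
rewrite -(mass_sum1 (k h)).
under [RHS]eq_esum do rewrite -q_pickle.
rewrite -(@esum_image R _ _ [set: T] (@pickle T) (fun n => (q h n)%:E)); last first.
  by move=> x y _ _ /(pcan_inj (@pickleK_inv T)).
rewrite [RHS]esum_mkcond; apply: eq_esum => n _; case: ifPn => //.
rewrite notin_setE => nT; rewrite /q; case E : (pickle_inv n) => [x|//].
by exfalso; apply: nT; exists x => //; have := @pickle_invK T n; rewrite E.
Qed.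

Let F_le1 h n : F h n <= 1.
Proof.
rewrite -lee_fin -(q_sum1 h) /F -sumEFin.
by apply: nneseries_lim_ge => i _ _; rewrite lee_fin.
Qed.

Let F_gt h v : v < 1 -> exists n, v < F h n.
Proof.
move=> v1; apply/not_existsP => nF.
have : (\sum_(n <oo) (q h n)%:E <= v%:E)%E.
  apply: lime_le; first by apply: is_cvg_ereal_nneg_natsum => n _; rewrite lee_fin.
  by apply: nearW => n; rewrite sumEFin lee_fin leNgt; apply/negP; exact: nF.
by rewrite q_sum1 lee_fin leNgt v1.
Qed.

Let Fixpoint iv (h : seq T) (a l : R) (w : seq T) : R * R :=
  if w is x :: w' then iv (rcons h x) (a + l * F h (pickle x)) (l * k h x) w'
  else (a, l).

Let iv_rcons h a l w x : iv h a l (rcons w x) =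
  ((iv h a l w).1 + (iv h a l w).2 * F (h ++ w) (pickle x),
   (iv h a l w).2 * k (h ++ w) x).
Proof.
elim: w h a l => [|y w IH] h a l /=; first by rewrite cats0.
by rewrite IH cat_rcons.
Qed.

Let lo w := (iv [:: x0] 0 1 w).1.
Let len w := (iv [:: x0] 0 1 w).2.

Let lo_rcons w x : lo (rcons w x) = lo w + len w * F (x0 :: w) (pickle x).
Proof. by rewrite /lo iv_rcons. Qed.

Let len_rcons w x : len (rcons w x) = len w * k (x0 :: w) x.
Proof. by rewrite /len iv_rcons. Qed.

Let len_prefix w : len w = prefix_prob w.
Proof.
elim/last_ind: w => [|w x IH]; first by rewrite /prefix_prob big_ord0.
rewrite len_rcons IH /prefix_prob size_rcons big_ord_recr/=; congr (_ * _).
  apply: eq_bigr => i _; rewrite nth_rcons ltn_ord; congr (k (_ :: _) _).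
  by rewrite -cats1 takel_cat// ltnW.
by rewrite -cats1 take_size_cat// nth_cat ltnn subnn.
Qed.

Let len_ge0 w : 0 <= len w.
Proof. by rewrite len_prefix prodr_ge0// => i _; exact: mass_ge0. Qed.

Let In u w := lo w <= u < lo w + len w.

Let In_rcons u w x : In u (rcons w x) -> In u w.
Proof.
rewrite /In lo_rcons len_rcons => /andP[l r]; apply/andP; split.
  by apply: le_trans l; rewrite lerDl mulr_ge0.
apply: (lt_le_trans r); rewrite -addrA lerD2l -mulrDr -q_pickle -FS.
by rewrite -[leRHS]mulr1 ler_wpM2l.
Qed.

Let In_nil u w : In u w -> In u [::].
Proof. by elim/last_ind: w => // w x IH /In_rcons. Qed.

Let In_uniq u w x y : In u (rcons w x) -> In u (rcons w y) -> x = y.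
Proof.
wlog xy : x y / (pickle x < pickle y)%N.
  move=> wl Ix Iy; have [xy|yx|] := ltngtP (pickle x) (pickle y).
  - exact: wl.
  - by apply/esym; exact: wl.
  - exact: (pcan_inj (@pickleK_inv T)).
rewrite /In !lo_rcons !len_rcons => /andP[_ r] /andP[l _].
exfalso; have := le_lt_trans l r; apply/negP; rewrite -leNgt.
by rewrite -addrA lerD2l -mulrDr -q_pickle -FS ler_wpM2l// F_homo.
Qed.

Let In_ex u w : In u w -> exists x, In u (rcons w x).
Proof.
move=> /andP[l r]; have l0 : 0 < len w.
  by have := le_lt_trans l r; rewrite ltrDl.
pose v := (u - lo w) / len w.
have uE : u = lo w + len w * v by rewrite /v mulrC divfK ?gt_eqF// addrC subrK.
have v0 : 0 <= v by rewrite divr_ge0// ?subr_ge0// ltW.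
have v1 : v < 1 by rewrite ltr_pdivrMr// mul1r ltrBlDl.
case: (ex_minnP (F_gt (x0 :: w) v1)) => -[|m].
  by rewrite /F big_nil ltNge v0.
move=> vF mmin; have Fv : F (x0 :: w) m <= v.
  by rewrite leNgt; apply/negP => /mmin; rewrite ltnn.
have : q (x0 :: w) m != 0.
  by apply: contraL vF => /eqP qm; rewrite FS qm addr0 -leNgt.
rewrite /q; case E : (pickle_inv m) => [x|]; rewrite ?eqxx// => _.
have mx : m = pickle x by have := @pickle_invK T m; rewrite E.
exists x; rewrite /In lo_rcons len_rcons {1 2}uE -addrA lerD2l ltrD2l.
by rewrite -mulrDr ler_pM2l// ltr_pM2l// -q_pickle -FS -mx Fv.
Qed.

Let hist (u : R) (n : nat) : seq T :=
  iter n (fun w => rcons w (xget x0 [set x | In u (rcons w x)])) [::].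

Let traj (u : measurableTypeR R) : runs x0 := fun n => last x0 (hist u n).

Let size_hist u n : size (hist u n) = n.
Proof. by elim: n => // n IH; rewrite /= size_rcons IH. Qed.

Let mkseq_traj u n : mkseq (traj u) n.+1 = x0 :: hist u n.
Proof.
elim: n => [//|n IH].
by rewrite mkseqS IH -rcons_cons /traj /= last_rcons.
Qed.

Let hist_In u n : In u [::] -> In u (hist u n).
Proof.
move=> u0; elim: n => // n IH /=; case: xgetP => [x _ //|nI].
by have [x Ix] := In_ex IH; case: (nI x).
Qed.

Let hist_eq u w : In u w -> hist u (size w) = w.
Proof.
elim/last_ind: w => // w x IH Ix; have Iw := In_rcons Ix.
rewrite size_rcons /= IH//; congr rcons; case: xgetP => [y _ Iy|/(_ x)//].
exact: In_uniq Iy Ix.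
Qed.

Let hist_out u n : ~ In u [::] -> hist u n = nseq n x0.
Proof.
move=> u0; elim: n => // n IH.
have -> : nseq n.+1 x0 = rcons (nseq n x0) x0 by elim: (n) => //= m <-.
by rewrite /= IH; congr rcons; case: xgetP => // y _ /In_nil.
Qed.

Let In_itv w : [set u | In u w] = [set` `[lo w, lo w + len w[%R].
Proof. by apply/seteqP; split => u /=; rewrite in_itv. Qed.

Let mIn w : measurable ([set u | In u w] : set (measurableTypeR R)).
Proof. by rewrite In_itv; exact: measurable_itv. Qed.

Let preimage_cylinder w : traj @^-1` cylinder x0 (x0 :: w) =
  [set u | In u w] `|`
  (if w == nseq (size w) x0 then ~` [set u | In u [::]] else set0).
Proof.
apply/seteqP; split => u; rewrite /preimage /cylinder/= mkseq_traj.
  move=> [wE]; have [u0|u0] := pselect (In u [::]).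
    by left; rewrite /= -wE; exact: hist_In.
  right; have := hist_out (size w) u0; rewrite wE => <-; rewrite eqxx.
  exact: u0.
move=> [/hist_eq ->//|]; case: eqP => // wE u0.
by rewrite hist_out// -wE.
Qed.

Let measurable_traj : measurable_fun [set: measurableTypeR R] traj.
Proof.
apply: (@measurability _ _ _ (runs x0) setT traj (cylinders x0)) => // _ [_ [w _ <-] <-].
rewrite setTI; case: w => [|x w].
  by rewrite (_ : _ @^-1` _ = setT)//; apply/seteqP; split.
have [->|xx0] := eqVneq x x0; last first.
  rewrite (_ : _ @^-1` _ = set0)//; apply/seteqP; split => u //=.
  by rewrite /cylinder/= => -[xE]; rewrite -xE eqxx in xx0.
rewrite preimage_cylinder; apply: measurableU; first exact: mIn.
by case: ifP => // _; apply: measurableC; exact: mIn.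
Qed.

Let mu : {measure set (measurableTypeR R) -> \bar R} :=
  mrestr (@lebesgue_measure R) (mIn [::]).

Let mu_setT : mu setT = 1%E.
Proof.
rewrite /mu/= /mrestr setTI In_itv.
by rewrite lebesgue_measure_itv/= /lo /len/= lte_fin add0r ltr01 sube0.
Qed.

Theorem trajectory_ex : exists P : probability (runs x0) R,
  forall w, P (cylinder x0 (x0 :: w)) = (prefix_prob w)%:E.
Proof.
exists (image_probability mu_setT measurable_traj) => w.
rewrite /image_probability/= /pushforward /mu/= /mrestr preimage_cylinder.
rewrite (_ : _ `&` _ = [set u | In u w]).
  rewrite In_itv lebesgue_measure_itv/= lte_fin ltrDl len_prefix.
  case: ltP; first by rewrite -EFinB addrAC subrr add0r.
  by rewrite -len_prefix => ?; congr EFin; apply/le_anti/andP.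
apply/seteqP; split => u /=.
  by move=> [[//|]]; case: ifP.
by move=> Iu; split; [left|exact: In_nil Iu].
Qed.

(* Such a P is unique: the cylinders, together with the empty set, are closed
   under intersection and generate the sigma-algebra, and (w empty) P gives
   probability 1 to the sequences starting at x0. *)
Definition trajectory : probability (runs x0) R := sval (cid trajectory_ex).

Lemma trajectory_cylinder w :
  trajectory (cylinder x0 (x0 :: w)) = (prefix_prob w)%:E.
Proof. exact: (svalP (cid trajectory_ex) w). Qed.
End Trajectory.

Section Coordinates.
Variables (T : countType) (x0 : T).

Lemma measurable_cylinder w : measurable (cylinder x0 w : set (runs x0)).
Proof. by apply: sub_sigma_algebra; exists w. Qed.

Lemma measurable_step d (Y : measurableType d) (f : T -> T -> Y) (n : nat) :
  measurable_fun [set: runs x0] (fun r : runs x0 => f (r n) (r n.+1)).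
Proof.
move=> _ B _; rewrite setTI.
rewrite (_ : _ @^-1` _ = \bigcup_(v in [set v | size v = n.+2 /\
    B (f (nth x0 v n) (nth x0 v n.+1))]) cylinder x0 v).
  rewrite bigcup_mkcond; apply: countable_bigcupT_measurable => // v.
  by case: ifP => // _; exact: measurable_cylinder.
apply/seteqP; split => r; rewrite /cylinder /=.
  move=> Br; exists (mkseq r n.+2); last by rewrite /= size_map size_iota.
  by split; [rewrite size_mkseq|rewrite !nth_mkseq].
by move=> [v /= [sv Bv] rv]; move: Bv; rewrite -rv sv !nth_mkseq.
Qed.
End Coordinates.

Section Projection.
Variables (T U : countType) (x0 : T) (u0 : U).

Definition fst_run (r : runs (x0, u0)) : runs x0 := fun n => (r n).1.

Lemma measurable_fst_run : measurable_fun [set: runs (x0, u0)] fst_run.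
Proof.
apply: (@measurability _ _ _ (runs x0) setT fst_run (cylinders x0)) => //.
move=> _ [_ [w _ <-] <-]; rewrite setTI.
rewrite (_ : _ @^-1` _ =
    \bigcup_(v in [set v | map fst v = w]) cylinder (x0, u0) v).
  rewrite bigcup_mkcond; apply: countable_bigcupT_measurable => // v.
  by case: ifP => // _; exact: measurable_cylinder.
apply/seteqP; split => r; rewrite /fst_run /cylinder /=.
  move=> rw; exists (mkseq r (size w)); last by rewrite /= size_mkseq.
  by rewrite /= -[RHS]rw /mkseq -map_comp.
move=> [v /= vw rv]; rewrite -vw size_map -[in RHS]rv.
by rewrite /mkseq -map_comp.
Qed.

HB.instance Definition _ :=
  isMeasurableFun.Build _ _ _ _ fst_run measurable_fst_run.
End Projection.

Record mdp (R : realType) := MDP {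
  state : countType;
  controlled : pred state;
  edge : rel state;
  edge_total : forall s, exists s', edge s s';
  (* only meaningful at random states, i.e. those that are not controlled *)
  trans : state -> distr R state;
  trans_supp : forall s, ~~ controlled s ->
    forall s', (0 < trans s s') = edge s s';
  reward : state -> state -> R }.

Section Strategies.
Variables (R : realType) (M : mdp R).
Let S := state M.

(* A history is a path s :: p (w.r.t. edge) such that last s p is controlled;
   the values of a strategy on other sequences are irrelevant. *)
Record strategy := Strategy {
  choose : seq S -> distr R S;
  choose_supp : forall s p, path (@edge R M) s p -> controlled (last s p) ->
    forall s', 0 < choose (s :: p) s' -> edge (last s p) s' }.

Definition strategy_kernel (s0 : S) (sigma : strategy) (w : seq S) :
    distr R S :=
  if controlled (last s0 w) then choose sigma w else trans (last s0 w).

Definition strategy_prob (s0 : S) (sigma : strategy) :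
    probability (runs s0) R :=
  trajectory s0 (strategy_kernel s0 sigma).

Record fm_strategy := FMStrategy {
  mode : finType;
  mode0 : mode;
  fm_choose : S -> mode -> distr R S;
  fm_choose_supp : forall s m, controlled s ->
    forall s', 0 < fm_choose s m s' -> edge s s';
  fm_update : mode -> S -> S -> distr R mode }.

Definition fm_kernel (s0 : S) (sigma : fm_strategy) (w : seq (S * mode sigma)) :
    distr R (S * mode sigma)%type :=
  let: (s, m) := last (s0, mode0 sigma) w in
  joint (if controlled s then fm_choose s m else trans s)
        (fun s' => fm_update m s s').

(* The law of the sequence of states when the pairs (state, mode) evolve
   according to sigma from (s0, mode0 sigma). *)
Definition fm_strategy_prob (s0 : S) (sigma : fm_strategy) :
    probability (runs s0) R :=
  distribution (trajectory (s0, mode0 sigma) (@fm_kernel s0 sigma))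
               (@fst_run _ _ s0 (mode0 sigma)).

Definition limsup_reward_ge0 (s0 : S) : set (runs s0) :=
  [set r | (0 <= limn_esup (fun n => (reward (r n) (r n.+1))%:E))%E].

Lemma measurable_limsup_reward_ge0 (s0 : S) :
  measurable (@limsup_reward_ge0 s0).
Proof.
pose f n (r : runs s0) := (@reward R M (r n) (r n.+1))%:E.
pose g (r : runs s0) : \bar R := limn_esup (f ^~ r).
have mf : measurable_fun setT g.
  apply: measurable_fun_limn_esup => n.
  exact: (measurable_step (fun s s' => (reward s s')%:E)).
rewrite (_ : @limsup_reward_ge0 s0 =
    setT `&` g @^-1` [set x | (0 <= x)%E]).
  apply: mf => //; rewrite (_ : [set _ | _] = `[0%E, +oo[%classic).
    exact: emeasurable_itv.
  by apply/seteqP; split => x /=; rewrite in_itv/= andbT.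
by rewrite setTI.
Qed.
End Strategies.
Arguments strategy_prob {R} M s0 sigma.
Arguments fm_strategy_prob {R} M s0 sigma.
Arguments limsup_reward_ge0 {R} M s0.

(* The index is shifted by one: c_ i, t_ i and rho_ i are the states
   numbered i + 1 of their kind, so that i ranges over all of nat. *)
Inductive ex_state := s_0 | c_ of nat | t_ of nat | rho_ of nat | sink.

Definition ex_state_code (s : ex_state) : nat * nat :=
  match s with
  | s_0 => (0, 0) | c_ i => (1, i) | t_ i => (2, i) | rho_ i => (3, i)
  | sink => (4, 0)
  end%N.

Definition ex_state_decode (x : nat * nat) : ex_state :=
  match x with
  | (0, _) => s_0 | (1, i) => c_ i | (2, i) => t_ i | (3, i) => rho_ i
  | _ => sink
  end%N.

Lemma ex_state_codeK : cancel ex_state_code ex_state_decode.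
Proof. by case. Qed.

HB.instance Definition _ := Countable.copy ex_state (can_type ex_state_codeK).

Section Example.
Variable R : realType.

Definition ex_controlled (s : ex_state) : bool :=
  match s with rho_ _ | sink => false | _ => true end.

Definition ex_edge (s s' : ex_state) : bool :=
  match s, s' with
  | s_0, c_ j => j == 0%N
  | c_ i, c_ j => j == i.+1
  | c_ i, rho_ j => j == i
  | rho_ i, t_ j => j == i
  | rho_ _, sink => true
  | t_ i, t_ j => i == j.+1
  | t_ i, s_0 => i == 0%N
  | sink, sink => true
  | _, _ => false
  end.

Lemma ex_edge_total (s : ex_state) : exists s', ex_edge s s'.
Proof.
case: s => [|i|[|i]|i|].
- by exists (c_ 0).
- by exists (rho_ i) => /=.
- by exists s_0.
- by exists (t_ i) => /=.
- by exists sink.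
- by exists sink.
Qed.

Lemma half_pow01 (i : nat) : 0 <= (2^-1 : R) ^+ i <= 1.
Proof. by rewrite exprn_ge0// exprn_ile1//; lra. Qed.

(* the value at controlled states is irrelevant *)
Definition ex_trans (s : ex_state) : distr R ex_state :=
  match s with
  | rho_ i => coin sink (t_ i) (half_pow01 i.+1)
  | _ => point_distr R sink
  end.

Lemma ex_trans_supp (s : ex_state) : ~~ ex_controlled s ->
  forall s', (0 < ex_trans s s') = ex_edge s s'.
Proof.
case: s => [|i|i|i|]//= _ s'.
  have p0 : 0 < (2^-1 : R) ^+ i.+1 by rewrite exprn_gt0//; lra.
  have p1 : (2^-1 : R) ^+ i.+1 < 1 by rewrite exprn_ilt1//; lra.
  case: s' => [|j|j|j|]; rewrite /= ?mulr0 ?addr0 ?mulr1 ?ltxx//.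
  rewrite add0r -[t_ j == t_ i]/(j == i) -[RHS]/(j == i).
  by case: (j == i); rewrite ?mulr1 ?mulr0 ?ltxx// subr_gt0.
by case: s' => [|j|j|j|]; rewrite /= subrr mul0r addr0 ?mulr0 ?mulr1 ?ltxx ?ltr01.
Qed.

Definition ex_reward (s s' : ex_state) : R :=
  match s, s' with
  | s_0, c_ _ | c_ _, c_ _ => -1
  | rho_ _, sink | sink, sink => -1
  | _, _ => 0
  end.

Definition ex_mdp : mdp R :=
  MDP ex_edge_total ex_trans_supp ex_reward.
End Example.

(* Main.v *)
Require Import Defs.
From mathcomp Require Import all_boot all_order all_algebra.
From mathcomp Require Import all_classical all_reals all_analysis.
From mathcomp Require Import lra ring.

(* A nonnegative supermartingale along histories that is at least 1 on a
   history-closed event bounds the probability of that event by its initial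
   value; both halves apply this.

   The strategy that climbs to index N + n in the n-th round has total risk at
   most the sum of the 2^-(N+n); the supermartingale is the risk still ahead.
   A run following this strategy outside the sink descends infinitely often.

   With finite memory, the pairs (state, mode) form a Markov chain with finitely
   many pairs over s_0. From each of them, either s_0 cannot be reached again, or
   some rho_i, hence the sink, is reached with positive probability before that.
   So in each round the return probability is at most some 1 - d < 1, and almost
   surely s_0 is visited finitely often; but nonnegative limsup forces
   infinitely many visits. *)

Set Implicit Arguments.
Unset Strict Implicit.
Unset Printing Implicit Defensive.
Import Order.TTheory GRing.Theory Num.Theory.
Import numFieldNormedType.Exports.
Local Open Scope classical_set_scope.
Local Open Scope ring_scope.

(** * Countable subadditivity and sums over discrete distributions *)

Lemma measure_bigcup_le_esum d (Y : measurableType d) (R : realType)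
    (mu : {measure set Y -> \bar R}) (W : countType) (A : set W)
    (C : W -> set Y) : (forall w, measurable (C w)) ->
  (mu (\bigcup_(w in A) C w) <= \esum_(w in A) mu (C w))%E.
Proof.
move=> mC.
(* The family is re-indexed by [nat] through [pickle]; non-codes and indices outside [A] receive
   [set0] and so add no measure. *)
pose F n := if pickle_inv n is Some w then if w \in A then C w else set0
            else set0 : set Y.
have mF n : measurable (F n).
  by rewrite /F; case: pickle_inv => // w; case: ifP.
have FP w : F (pickle w) = if w \in A then C w else set0.
  by rewrite /F pickleK_inv.
have -> : \bigcup_(w in A) C w = \bigcup_n F n.
  apply/seteqP; split=> y.
    by move=> [w Aw Cy]; exists (pickle w) => //; rewrite FP mem_set.
  move=> [n _]; rewrite /F; case: pickle_inv => // w.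
  by case: ifPn => // /set_mem Aw Cy; exists w.
apply: le_trans (measure_sigma_subadditive _ _ _ (@subset_refl _ _)) _ => //.
  exact: bigcupT_measurable.
rewrite nneseries_esumT// [leRHS]esum_mkcond.
rewrite [leRHS](_ : _ = \esum_(w in [set: W]) mu (F (pickle w))); last first.
  by apply: eq_esum => w _; rewrite FP; case: ifP => //; rewrite measure0.
rewrite -(@esum_image R _ _ [set: W] (@pickle W) (fun n => mu (F n)));
    last first.
  by move=> x y _ _ /(pcan_inj (@pickleK_inv W)).
rewrite [leRHS]esum_mkcond; apply: le_esum => n _; case: ifPn => //.
rewrite notin_setE => nW; rewrite /F; case E : (pickle_inv n) => [w|].
  by exfalso; apply: nW; exists w => //; have := @pickle_invK W n; rewrite E.
by rewrite measure0.
Qed.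

Lemma esum_ge_term (R : realType) (T : countType) (a : T -> R)
    (y : T) : (forall x, 0 <= a x) ->
  ((a y)%:E <= \esum_(x in [set: T]) (a x)%:E)%E.
Proof.
move=> a0; rewrite -(@esum_set1 R T y (fun x => (a x)%:E)) ?lee_fin//.
by rewrite esum_mkcond; apply: le_esum => x _; case: ifP; rewrite lee_fin.
Qed.

Lemma distr_gt0 (R : realType) (U : countType) (p : distr R U) :
  exists x, 0 < p x.
Proof.
apply/not_existsP => np; have := mass_sum1 p.
rewrite esum1 => [/eqP|x _]; first by rewrite eqe eq_sym oner_eq0.
apply/eqP; rewrite eqe; have := mass_ge0 p x.
by rewrite le_eqVlt eq_sym => /orP[//|/np].
Qed.

Lemma esum_coin (R : realType) (T : countType) (x y : T) (p : R)
    (p01 : 0 <= p <= 1) (f : T -> R) : (forall z, 0 <= f z) ->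
  \esum_(z in [set: T]) (coin x y p01 z * f z)%:E =
  (p * f x + (1 - p) * f y)%:E.
Proof.
move=> f0; have /andP[p0 p1] := p01.
have px : 0 <= p * f x by rewrite mulr_ge0.
have py : 0 <= (1 - p) * f y by rewrite mulr_ge0 ?subr_ge0.
rewrite EFinD -(esum_pred1 x px) -(esum_pred1 y py) -esumD.
- apply: eq_esum => z _; rewrite -EFinD /=; congr EFin.
  by case: (eqVneq z x) => [->|_]; case: (eqVneq _ y) => [->|_] /=; ring.
- by move=> z _; rewrite lee_fin mulr_ge0.
- by move=> z _; rewrite lee_fin mulr_ge0.
Qed.

Lemma point_distr_gt0 (R : realType) (T : countType) (x z : T) :
  0 < point_distr R x z -> z = x.
Proof.
by case: (eqVneq z x) => // /negPf zx; rewrite /= zx !mulr0 addr0 ltxx.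
Qed.

Lemma mkseq_consS (T : Type) (r : nat -> T) n :
  mkseq r n.+1 = r 0%N :: mkseq (fun i => r i.+1) n.
Proof. by rewrite /mkseq/= (iotaDl 1%N 0%N n) -map_comp. Qed.

Lemma cylinder_mkseq (T : countType) (x0 : T) (r : run x0) n :
  cylinder x0 (mkseq r n) r.
Proof. by rewrite /cylinder/= size_mkseq. Qed.

(** * Supermartingales along histories *)

Section Supermartingale.
Variables (R : realType) (T : countType) (x0 : T) (k : seq T -> distr R T).
Let P : probability (runs x0) R := trajectory x0 k.

Lemma prefix_prob_ge0 w : 0 <= prefix_prob x0 k w.
Proof. by rewrite prodr_ge0// => i _; exact: mass_ge0. Qed.

Lemma prefix_prob_rcons w x :
  prefix_prob x0 k (rcons w x) = prefix_prob x0 k w * k (x0 :: w) x.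
Proof.
rewrite /prefix_prob size_rcons big_ord_recr/=; congr (_ * _).
  apply: eq_bigr => i _; rewrite nth_rcons ltn_ord; congr (k (_ :: _) _).
  by rewrite -cats1 takel_cat// ltnW.
by rewrite -cats1 take_size_cat// nth_cat ltnn subnn.
Qed.

Lemma trajectory_bigcup_le (A : set (seq T)) :
  (P (\bigcup_(w in A) cylinder x0 (x0 :: w)) <=
   \esum_(w in A) (prefix_prob x0 k w)%:E)%E.
Proof.
apply: le_trans (measure_bigcup_le_esum _ _ _) _.
  by move=> w; exact: measurable_cylinder.
by apply: le_esum => w _; rewrite -(trajectory_cylinder x0 k w).
Qed.

(** A run from [x0] that takes a step of probability 0 lies in a cylinder of measure 0, and there
    are only countably many cylinders. *)
Lemma ae_trajectory : {ae P, forall r,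
  r 0%N = x0 /\ forall n, 0 < k (mkseq r n.+1) (r n.+1)}.
Proof.
pose Z := [set w | prefix_prob x0 k w = 0].
have mc w : measurable (cylinder x0 w : set (runs x0)).
  exact: measurable_cylinder.
have mZ : measurable
    (\bigcup_(w in Z) cylinder x0 (x0 :: w) : set (runs x0)).
  by rewrite bigcup_mkcond; apply: countable_bigcupT_measurable => // w;
    case: ifP.
apply: (@negligibleS _ _ _ P
    (~` cylinder x0 [:: x0] `|` \bigcup_(w in Z) cylinder x0 (x0 :: w)));
    last first.
  apply: negligibleU; apply/negligibleP => //.
  - exact: measurableC.
  - have P1 : P (cylinder x0 [:: x0]) = 1%E.
      by have := trajectory_cylinder x0 k [::]; rewrite /prefix_prob big_ord0.
    by have := probability_setC P (mc [:: x0]); rewrite P1 subee.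
  - apply/eqP; rewrite -measure_le0; apply: le_trans (trajectory_bigcup_le _) _.
    by rewrite esum1// => w ->.
move=> r /= nr; have [r0|r0] := pselect (r 0%N = x0); last first.
  by left; rewrite /cylinder/= /mkseq /= => -[].
right; have [n kn] : exists n, k (mkseq r n.+1) (r n.+1) = 0.
  apply/not_existsP => nk; apply: nr; split => // n.
  by rewrite lt0r mass_ge0 andbT; apply/eqP; exact: nk.
have rE m : mkseq r m.+1 = x0 :: mkseq (fun i => r i.+1) m.
  by rewrite mkseq_consS r0.
exists (mkseq (fun i => r i.+1) n.+1).
  by rewrite /Z /= mkseqS prefix_prob_rcons -rE kn mulr0.
by rewrite -rE; exact: cylinder_mkseq.
Qed.

Variable phi : seq T -> R.
Hypothesis phi_ge0 : forall w, 0 <= phi w.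
Hypothesis phi_super : forall w,
  (\esum_(x in [set: T]) (k (x0 :: w) x * phi (rcons (x0 :: w) x))%:E <=
   (phi (x0 :: w))%:E)%E.

(** The left side is the expectation of [phi] after [n] steps. For the induction, a word of length
    [n.+1] is split into its first [n] letters and its last one, and the inner sum is bounded by
    [phi_super]. *)
Lemma esum_supermartingale n :
  (\esum_(w in [set w : seq T | size w = n])
     (prefix_prob x0 k w * phi (x0 :: w))%:E <= (phi [:: x0])%:E)%E.
Proof.
elim: n => [|n IH].
  rewrite (_ : [set _ | _] = [set [::]]); last first.
    by apply/seteqP; split => w /=; [move/size0nil|move=> ->].
  by rewrite esum_set1 ?lee_fin /prefix_prob big_ord0 mul1r.
apply: le_trans IH.
pose rc (p : seq T * T) := rcons p.1 p.2.
rewrite (_ : [set w | _] = rc @` ([set w | size w = n] `*`` fun=> [set: T]));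
    last first.
  apply/seteqP; split => w /=.
    case/lastP: w => // w x; rewrite size_rcons => -[wn].
    by exists (w, x).
  by move=> [[v x] /= [vn _] <-]; rewrite size_rcons vn.
rewrite esum_image; last first.
  by move=> [v x] [w y] _ _ /rcons_inj[-> ->].
rewrite -(esum_esum (a := fun w x =>
    (prefix_prob x0 k (rcons w x) * phi (x0 :: rcons w x))%:E)); last first.
  by move=> w x _ _; rewrite lee_fin mulr_ge0 ?prefix_prob_ge0.
apply: le_esum => w _.
under eq_esum do rewrite prefix_prob_rcons -mulrA -rcons_cons.
rewrite esumZl ?prefix_prob_ge0//; last first.
  by move=> x; rewrite mulr_ge0 ?mass_ge0.
by rewrite EFinM lee_wpmul2l ?lee_fin ?prefix_prob_ge0.
Qed.

(** Markov's inequality at each fixed time, followed by continuity from below: since [A] is closed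
    under extension, the events that [A] holds at time [n] increase with [n], and almost all of [E]
    lies in their union. *)
Lemma supermartingale_le (A : set (seq T)) (E : set (runs x0)) :
  (forall w x, A w -> A (rcons w x)) -> (forall w, A w -> 1 <= phi w) ->
  measurable E ->
  (forall r, r 0%N = x0 -> (forall n, 0 < k (mkseq r n.+1) (r n.+1)) ->
    E r -> exists n, A (mkseq r n.+1)) ->
  (P E <= (phi [:: x0])%:E)%E.
Proof.
move=> Amono A1 mE EA.
pose U n := \bigcup_(w in [set w | size w = n /\ A (x0 :: w)])
  (cylinder x0 (x0 :: w) : set (runs x0)).
have mU n : measurable (U n).
  rewrite /U bigcup_mkcond; apply: countable_bigcupT_measurable => // v.
  by case: ifP => // _; exact: measurable_cylinder.
have mUU : measurable (\bigcup_n U n) by exact: bigcupT_measurable.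
have UE n r : r 0%N = x0 -> U n r <-> A (mkseq r n.+1).
  move=> r0; have rE m : mkseq r m.+1 = x0 :: mkseq (fun i => r i.+1) m.
    by rewrite mkseq_consS r0.
  split.
    by move=> [w [wn Aw]]; rewrite /cylinder/= wn => ->.
  rewrite rE => Ar; exists (mkseq (fun i => r i.+1) n).
    by split => //; rewrite size_mkseq.
  by rewrite -rE; exact: cylinder_mkseq.
have U0 n r : U n r -> r 0%N = x0 by move=> [w _ []].
have : P.-negligible (E `\` \bigcup_n U n).
  apply: (negligibleS _ ae_trajectory) => r [Er nUr] [r0 rk].
  have [n An] := EA r r0 rk Er.
  by apply: nUr; exists n => //; apply/UE.
move/measure_negligible => /(_ (measurableD mE mUU)) EU0.
have : (P E <= P (\bigcup_n U n))%E.
  rewrite -[leRHS]add0e -[X in (X + _)%E]EU0 -measureU//; last 2 first.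
  - exact: measurableD.
  - by rewrite setDE -setIA setICl setI0.
  rewrite le_measure ?inE//.
    by apply: measurableU => //; exact: measurableD.
  by move=> r Er; have [?|?] := pselect ((\bigcup_n U n) r); [right|left].
move/le_trans; apply.
have PU n : (P (U n) <= (phi [:: x0])%:E)%E.
  apply: le_trans (trajectory_bigcup_le _) _.
  apply: le_trans (esum_supermartingale n).
  (* Words in [A] carry [phi] at least 1; the others only add nonnegative terms. *)
  rewrite (_ : [set _ | _] = [set w | size w = n] `&` [set w | A (x0 :: w)])//.
  rewrite esum_mkcondr; apply: le_esum => w _; case: ifPn => [/set_mem Aw|_].
    by rewrite lee_fin ler_peMr ?prefix_prob_ge0//; exact: A1.
  by rewrite lee_fin mulr_ge0 ?prefix_prob_ge0.
have ndU : nondecreasing_seq U.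
  apply/nondecreasing_seqP => n; apply/subsetPset => r Ur.
  have r0 := U0 _ _ Ur; apply/UE => //; rewrite mkseqS; apply: Amono.
  exact/UE.
have := nondecreasing_cvg_mu mU mUU ndU => /(_ _ P) cU.
rewrite -(cvg_lim _ cU)//; apply: lime_le.
  by apply/cvg_ex; eexists; exact: cU.
by apply: nearW => n /=; exact: PU.
Qed.
End Supermartingale.

(** * Markov chains that almost surely visit a finite set only finitely often *)

Section MarkovChain.
Variables (R : realType) (T : countType) (K : T -> distr R T) (B : pred T).

(* A lower bound for the probability of never entering B after the first
   step. *)
Definition escape_bound (h : T -> R) := (forall x, 0 <= h x <= 1) /\
  forall x, ((h x)%:E <=
    \esum_(y in [set: T]) (K x y * ((~~ B y)%:R * h y))%:E)%E.

Lemma escape_bound_le (h g : T -> R) x : escape_bound h ->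
  (forall y, h y <= g y) ->
  ((h x)%:E <= \esum_(y in [set: T]) (K x y * ((~~ B y)%:R * g y))%:E)%E.
Proof.
move=> [_ hle] hg; apply: le_trans (hle x) _; apply: le_esum => y _.
by rewrite lee_fin ler_wpM2l ?mass_ge0// ler_wpM2l.
Qed.

Lemma escape_bound_max (h g : T -> R) : escape_bound h -> escape_bound g ->
  escape_bound (fun x => Num.max (h x) (g x)).
Proof.
move=> hb gb; split=> x.
  have [/(_ x)/andP[h0 h1] _] := hb; have [/(_ x)/andP[g0 g1] _] := gb.
  by rewrite le_max h0 ge_max h1 g1.
have [hg|gh] := leP (h x) (g x).
  by apply: escape_bound_le gb _ => y; rewrite le_max lexx orbT.
by apply: escape_bound_le hb _ => y; rewrite le_max lexx.
Qed.

(** The new value at [x] is a single term of the sum that has to dominate it. *)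
Lemma escape_bound_step (h : T -> R) x y : escape_bound h -> ~~ B y ->
  escape_bound (fun z => if z == x then Num.max (h z) (K x y * h y) else h z).
Proof.
move=> hb By; set g := fun z => _.
have [h01 _] := hb.
have Kh0 : 0 <= K x y * h y.
  by rewrite mulr_ge0 ?mass_ge0//; have /andP[] := h01 y.
have hg z : h z <= g z by rewrite /g; case: ifP => // _; rewrite le_max lexx.
have g0 z : 0 <= g z by apply: le_trans (hg z); have /andP[] := h01 z.
have K1 : K x y <= 1.
  by rewrite -lee_fin -(mass_sum1 (K x)); apply: esum_ge_term; exact: mass_ge0.
split=> z.
  rewrite g0 /g/=; have /andP[h0 h1] := h01 z; case: ifP => // _.
  rewrite ge_max h1 mulr_ile1 ?mass_ge0//; by have /andP[] := h01 y.
rewrite {1}/g; case: eqP => [->|_]; last exact: escape_bound_le hb hg.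
rewrite maxEle; case: ifP => _; last exact: escape_bound_le hb hg.
have := @esum_ge_term _ _ (fun z => K x z * ((~~ B z)%:R * g z)) y.
rewrite By mul1r => le_; apply: le_trans (le_ _).
  by rewrite lee_fin ler_wpM2l ?mass_ge0.
by move=> u; rewrite !mulr_ge0 ?mass_ge0.
Qed.

(** At least one step is taken, so for [x] in [B] this speaks of a return. *)
Inductive reach : T -> Prop :=
| reach_here x y : 0 < K x y -> B y -> reach x
| reach_step x y : 0 < K x y -> reach y -> reach x.

(** A finite witness that, after the first step, [B] is avoided forever with positive
    probability. *)
Inductive escapes : T -> Prop :=
| escapes_here x : ~ reach x -> escapes x
| escapes_step x y : 0 < K x y -> ~~ B y -> escapes y -> escapes x.

Lemma escapes_bound x : escapes x -> exists2 h, escape_bound h & 0 < h x.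
Proof.
elim=> {x} [x nx|x y Kxy By _ [h hb hy]].
  (* The indicator of the points that cannot reach [B]: from such a point, every successor of
     positive probability is outside [B] and again cannot reach it. *)
  exists (fun z => (`[< ~ reach z >])%:R); last by rewrite asboolT.
  split=> z; first by case: asboolP; rewrite ?ler01 ?lexx.
  case: asboolP => [nz|_]; last first.
    by apply: esum_ge0 => y _; rewrite lee_fin !mulr_ge0 ?mass_ge0.
  rewrite -(mass_sum1 (K z)); apply: le_esum => y _; rewrite lee_fin.
  have := mass_ge0 (K z) y; rewrite le_eqVlt => /orP[/eqP <-|Kzy].
    by rewrite mul0r.
  have -> : ~~ B y by apply/negP => By; apply: nz; exact: reach_here Kzy By.
  rewrite asboolT ?mulr1// => ry; apply: nz; exact: reach_step Kzy ry.
exists (fun z => if z == x then Num.max (h z) (K x y * h y) else h z).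
  exact: escape_bound_step.
by rewrite eqxx lt_max mulr_gt0 ?orbT.
Qed.

(** Bounds for single points are merged by pointwise maximum; as the list is finite, the minimum of
    their positive values is a uniform [d]. *)
Lemma escapes_bound_seq (s : seq T) : (forall x, x \in s -> escapes x) ->
  exists h d, [/\ escape_bound h, 0 < d <= 1 & forall x, x \in s -> d <= h x].
Proof.
elim: s => [_|x s IH sP].
  exists (fun=> 0), 1; split=> //; last by rewrite ltr01 lexx.
  split=> x; first by rewrite lexx ler01.
  by rewrite esum_ge0// => y _; rewrite !mulr0.
have [|h [d [hb /andP[d0 d1] hs]]] := IH.
  by move=> y ys; apply: sP; rewrite inE ys orbT.
have [|g gb gx] := @escapes_bound x; first by apply: sP; rewrite inE eqxx.
exists (fun x => Num.max (h x) (g x)), (Num.min d (g x)); split.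
- exact: escape_bound_max.
- by rewrite lt_min d0 gx ge_min d1.
- move=> y; rewrite inE => /orP[/eqP ->|ys].
    by rewrite ge_min !le_max lexx !orbT.
  by rewrite ge_min le_max hs.
Qed.

(* As h bounds from below the probability of never returning to B, 1 + (1 - h),
   with each visit of B weighted by (1 - d / 2)^-1, is a supermartingale. *)
Lemma escape_bound_esum (h : T -> R) (d : R) x :
  escape_bound h -> 0 < d <= 1 -> (forall y, B y -> d <= h y) ->
  (\esum_(y in [set: T])
     (K x y * ((1 - d / 2)^-1 ^+ B y * (2 - h y)))%:E <= (2 - h x)%:E)%E.
Proof.
move=> [h01 hle] /andP[d0 d1] dh.
have l0 : 0 < 1 - d / 2 by lra.
pose a y := K x y * (2 - (~~ B y)%:R * h y).
pose b y := K x y * ((~~ B y)%:R * h y).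
have b0 y : 0 <= b y.
  by rewrite !mulr_ge0 ?mass_ge0//; have /andP[] := h01 y.
have a0 y : 0 <= a y.
  rewrite mulr_ge0 ?mass_ge0//; have /andP[] := h01 y.
  by case: (B y); rewrite ?mul0r ?mul1r; lra.
apply: (@le_trans _ _ (\esum_(y in [set: T]) (a y)%:E)%E).
  apply: le_esum => y _; rewrite lee_fin ler_wpM2l ?mass_ge0//.
  (* On [B], [2 - h y] is at most [2 - d], that is [2 * (1 - d / 2)]; so the weight [(1 - d / 2)^-1]
     brings it to at most 2. *)
  case By : (B y); last by rewrite expr0 !mul1r.
  rewrite expr1 mul0r subr0 mulrC ler_pdivrMr//.
  by have := dh y By; lra.
(* As [K x] has mass 1, the sum of [a] is 2 minus that of [b], and the latter is at least [h x]. *)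
have ab : (\esum_(y in [set: T]) (a y)%:E + \esum_(y in [set: T]) (b y)%:E =
           2%:E)%E.
  rewrite -esumD; [|by move=> y _; rewrite lee_fin..].
  transitivity (\esum_(y in [set: T]) (2 * K x y)%:E)%E.
    by apply: eq_esum => y _; rewrite -EFinD -mulrDr subrK mulrC.
  by rewrite esumZl ?mass_sum1 ?mule1//; exact: mass_ge0.
rewrite EFinB leeBrDr// -ab leeD2l//; exact: hle.
Qed.

(** For every [j], the event forces at least [j] visits to [B], whose probability is bounded by a
    constant times [(1 - d / 2) ^+ j]. *)
Lemma finitely_many_visits (x0 : T) (k : seq T -> distr R T)
    (E : set (runs x0)) :
  (forall w, k (x0 :: w) = K (last x0 w)) ->
  finite_set [set x | B x] -> (forall x, B x -> escapes x) ->
  measurable E ->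
  (forall r, (forall n, 0 < K (r n) (r n.+1)) -> E r ->
    forall N, exists2 n, (N <= n)%N & B (r n)) ->
  trajectory x0 k E = 0%E.
Proof.
move=> kK /finite_seqP[s Bs] Besc mE EB.
have Bin x : B x = (x \in s).
  by have /= e := congr1 (fun A => A x) Bs; apply/idP/idP; rewrite e.
have [|h [d [hb d01 hs]]] := @escapes_bound_seq s.
  by move=> x xs; apply: Besc; rewrite Bin.
have dh y : B y -> d <= h y by rewrite Bin; exact: hs.
have [h01 _] := hb; have /andP[d0 d1] := d01.
set m := 1 - d / 2; have m0 : 0 < m by rewrite /m; lra.
have m1 : m < 1 by rewrite /m; lra.
(* The factor [m ^+ j] is cancelled after [j] visits; since [2 - h] is at least 1, [phi j] is then
   at least 1. *)
pose phi j (w : seq T) := m ^+ j * m^-1 ^+ count B w * (2 - h (last x0 w)).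
have phi0 j w : 0 <= phi j w.
  rewrite !mulr_ge0 ?exprn_ge0 ?invr_ge0 ?(ltW m0)//.
  by have /andP[] := h01 (last x0 w); lra.
have PE j : (trajectory x0 k E <= (phi j [:: x0])%:E)%E.
  refine (@supermartingale_le _ _ _ k (phi j) _ _
     [set w | (j <= count B w)%N] E _ _ _ _) => //.
  - move=> w; rewrite kK; set x := last x0 w.
    rewrite [leLHS](_ : _ =
    \esum_(y in [set: T]) (m ^+ j * m^-1 ^+ count B (x0 :: w) *
      (K x y * (m^-1 ^+ B y * (2 - h y))))%:E)%E; last first.
      apply: eq_esum => y _; congr EFin; rewrite /phi last_rcons.
      by rewrite -cats1 count_cat [count B [:: y]]/= addn0 exprD; ring.
    rewrite esumZl; first last.
    - move=> y; rewrite !mulr_ge0 ?mass_ge0 ?exprn_ge0 ?invr_ge0 ?(ltW m0)//.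
      by have /andP[] := h01 y; lra.
    - by rewrite mulr_ge0 ?exprn_ge0 ?invr_ge0 ?(ltW m0).
    rewrite /phi [leRHS]EFinM lee_wpmul2l//; last exact: escape_bound_esum.
    by rewrite lee_fin mulr_ge0 ?exprn_ge0 ?invr_ge0 ?(ltW m0).
  - move=> w x /= jw; rewrite -cats1 count_cat; apply: leq_trans jw _.
    exact: leq_addr.
  - move=> w /= jw; rewrite /phi.
    rewrite -(subnKC jw) exprD mulrA -exprMn divff ?gt_eqF// expr1n mul1r.
    rewrite -[leLHS]mul1r ler_pM//.
      by rewrite exprn_ege1// invf_ge1// ltW.
    by have /andP[] := h01 (last x0 w); lra.
  - move=> r r0 rk Er; have inf : forall N, exists2 n, (N <= n)%N & B (r n).
      apply: EB Er => n; have := rk n.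
      rewrite mkseq_consS r0 kK (last_nth x0) size_mkseq -r0.
      by rewrite -mkseq_consS nth_mkseq.

    elim: j => [|j [n jn]]; first by exists 0%N.
    have [i ni Bi] := inf n.+1.
    exists i; suff: (j < count B (mkseq r i.+1))%N by [].
    rewrite mkseqS -cats1 count_cat [count B [:: _]]/= Bi addn0 addn1 ltnS.
    apply: leq_trans jn _; rewrite -[in leqRHS](subnKC ni) /mkseq iotaD map_cat.
    by rewrite count_cat leq_addr.
set c := m^-1 ^+ count B [:: x0] * (2 - h x0).
have cvg0 : (fun j => (m ^+ j * c)%:E) @ \oo --> 0%E.
  apply: cvg_EFin; first by exact: nearW.
  rewrite -[X in _ --> X](mul0r c); apply: cvgMl.
  by apply: cvg_expr; rewrite ger0_norm ?ltW.
apply/eqP; rewrite eq_le measure_ge0 andbT -(cvg_lim _ cvg0)//.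
apply: lime_ge; first by apply/cvg_ex; eexists; exact: cvg0.
by apply: nearW => j; rewrite mulrA; exact: PE.
Qed.
End MarkovChain.

(** * The limsup event in terms of zero rewards and visits to [s_0] *)

Lemma limsup_reward_ge0P (R : realType) (r : run s_0) :
  limsup_reward_ge0 (ex_mdp R) s_0 r <->
  forall N, exists2 n, (N <= n)%N & ex_reward R (r n) (r n.+1) = 0.
Proof.
rewrite /limsup_reward_ge0 /= limn_esup_lim; set u := fun n => _.
split=> [r0 N|r0].
  apply/not_exists2P => nex.
  (* Rewards are only 0 or -1, so a nonzero reward stays a full unit below 0. *)
  have uN n : (N <= n)%N -> (u n <= -1)%E.
    move=> Nn; rewrite -EFinN lee_fin.
    have [//|] := nex n; rewrite /u /=.
    by case: (r n) => [|i|i|i|]; case: (r n.+1) => [|j|j|j|].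
  suff : (limn (esups u) <= -1)%E.
    by move/(le_trans r0); rewrite -EFinN lee_fin; lra.
  apply: lime_le; first exact: is_cvg_esups.
  exists N => // n /= Nn; apply: ub_ereal_sup => _ [k /= nk <-].
  by apply: uN; exact: leq_trans Nn nk.
apply: lime_ge; first exact: is_cvg_esups.
apply: nearW => N; have [n Nn rn] := r0 N.
by apply: ereal_sup_ubound; exists n => //; rewrite /u /= rn.
Qed.

(** Suppose [s_0] is avoided from time [N] on. Then so is every [t_ i], and a zero reward can only
    come from entering some [rho_ i]; the next state is then [sink], after which all rewards are
    -1. *)
Lemma zero_reward_start (R : realType) (s : nat -> ex_state) :
  (forall n, ex_edge (s n) (s n.+1)) ->
  (forall N, exists2 n, (N <= n)%N & ex_reward R (s n) (s n.+1) = 0) ->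
  forall N, exists2 n, (N <= n)%N & s n = s_0.
Proof.
move=> sE inf N; apply/not_exists2P => nex.
have ns n : (N <= n)%N -> s n <> s_0 by move=> Nn; have [] := nex n.
(* The descent from [t_ i] is forced and ends in [s_0] after [i.+1] steps. *)
have nt i n : (N <= n)%N -> s n <> t_ i.
  elim: i n => [|i IH] n Nn sn; have := sE n; rewrite sn;
    case sn1 : (s n.+1) => [|j|j|j|]//=.
  - by have := ns _ (leqW Nn); rewrite sn1.
  - by move=> /eqP[ij]; apply: (IH n.+1); rewrite ?leqW// sn1 ij.
have sink_stable n m : (n <= m)%N -> s n = sink -> s m = sink.
  move=> /subnKC <-; elim: (m - n)%N => [|d IH]; first by rewrite addn0.
  move=> /IH; rewrite addnS; have := sE (n + d)%N => /[swap] ->.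
  by case: (s _).
have [n Nn rn] := inf N.
have [i] : exists i, s n.+1 = rho_ i \/ s n.+1 = sink.
  move: rn (ns n Nn) (ns n.+1 (leqW Nn)) (nt^~ n^~ Nn) (nt^~ n.+1^~ (leqW Nn)).
  have := sE n.
  case: (s n) => [|j|j|j|]; case: (s n.+1) => [|l|l|l|]//=.
  - by move=> _ /eqP; rewrite oppr_eq0 oner_eq0.
  - by exists l; left.
  - by move=> _ _ _ _ /(_ j).
  - by move=> _ _ _ _ _ /(_ l).
  - by exists 0%N; right.
  - by exists 0%N; right.
move=> sn1; have sn2 : s n.+2 = sink.
  have := sE n.+1; case: sn1 => ->; last by case: (s n.+2).
  case sn2 : (s n.+2) => [|j|j|j|]//= _.
  by have /(_ j n.+2) := nt; rewrite sn2 => /(_ (leqW (leqW Nn))).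
have [m nm] := inf n.+2.
rewrite !(sink_stable _ _ _ sn2) ?leqW// => /eqP.
by rewrite /= oppr_eq0 oner_eq0.
Qed.

(** * Finite-memory strategies *)

Section FiniteMemory.
Variables (R : realType) (sigma : fm_strategy (ex_mdp R)).
Let T : countType := (state (ex_mdp R) * mode sigma)%type.

Let K (x : T) : distr R T :=
  let: (s, m) := x in
  joint (if controlled s then fm_choose s m else trans s)
        (fun s' => fm_update m s s').

Let B : pred T := fun x => x.1 == s_0.

Let K_edge x y : 0 < K x y -> ex_edge x.1 y.1.
Proof.
case: x => s m; rewrite /K /=.
have := mass_ge0 (if controlled s then fm_choose s m else trans s) y.1.
rewrite le_eqVlt => /orP[/eqP <-|+ _]; first by rewrite mul0r ltxx.
case: ifPn => [cs|ncs]; first exact: fm_choose_supp.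
by rewrite (trans_supp ncs).
Qed.

Let sink_unreach x : x.1 = sink -> ~ reach K B x.
Proof.
move=> xs rx; elim: rx xs => {x} [[s m] [s' m'] /K_edge e By|
    [s m] [s' m'] /K_edge e _ IH] /= xs; move: e; rewrite xs /=.
  by move: By => /eqP /= ->.
by case: s' IH => // IH _; exact: IH.
Qed.

(** A way back to [s_0] from [s_0] or some [c_ i] goes up through the [c_ j] and then enters some
    [rho_ j]. Following it that far and then falling into [sink], which has positive probability at
    [rho_ j], gives an escape. *)
Let climb_escapes x : reach K B x ->
  match x.1 with s_0 | c_ _ => escapes K B x | _ => True end.
Proof.
elim=> {x} [x y /K_edge|x y Kxy _ IH].
  by case: x => -[|i|i|i|]//= m; case: y => -[].
have := K_edge Kxy; move: IH Kxy.
case: x => -[|i|i|i|]//= m; case: y => -[|j|j|j|]//= m' IH Kxy _.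
- exact: (@escapes_step _ _ K B (s_0, m) (c_ j, m')).
- exact: (@escapes_step _ _ K B (c_ i, m) (c_ j, m')).
apply: (@escapes_step _ _ K B (c_ i, m) (rho_ j, m')) => //.
have [m'' um] := distr_gt0 (fm_update m' (rho_ j : state (ex_mdp R)) sink).
apply: (@escapes_step _ _ K B _ (sink, m'')) => //.
  have ts := @trans_supp R (ex_mdp R) (rho_ j) isT sink.
  by apply: mulr_gt0 um; rewrite ts.
by apply: escapes_here; exact: sink_unreach.
Qed.

(** Finite memory enters through the finiteness of [B], which has one pair for each mode. *)
Lemma fm_limsup_reward0 :
  fm_strategy_prob (ex_mdp R) s_0 sigma
    (limsup_reward_ge0 (ex_mdp R) s_0) = 0%E.
Proof.
rewrite /fm_strategy_prob /distribution /= /pushforward.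
apply: (@finitely_many_visits _ _ K B).
- by move=> w; rewrite /fm_kernel /K /=; case: (last _ w).
- apply: (@sub_finite_set _ _
    ((fun m => (s_0 : state (ex_mdp R), m)) @` [set: mode sigma])).
    by move=> [s m] /eqP /= ->; exists m.
  exact: finite_image.
- move=> x Bx; have [rx|] := pselect (reach K B x); last exact: escapes_here.
  by have := climb_escapes rx; rewrite (eqP Bx).
- rewrite -[X in measurable X]setTI; apply: measurable_fst_run => //.
  exact: measurable_limsup_reward_ge0.
- move=> r rK /limsup_reward_ge0P inf N.
  have [|n Nn rn] := @zero_reward_start R (fst_run r) _ inf N.
    by move=> n; exact: K_edge (rK n).
  by exists n => //; apply/eqP.
Qed.
End FiniteMemory.

(** * The climbing strategy *)

Section Climb.
Variables (R : realType) (N : nat).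

(** The start counts as a visit, so the first round has level [N.+1]. *)
Definition level (w : seq ex_state) := (N + count (pred1 s_0) w)%N.

Definition climb_next (w : seq ex_state) : ex_state :=
  match last s_0 w with
  | s_0 => c_ 0
  | c_ i => if (i < level w)%N then c_ i.+1 else rho_ i
  | t_ i.+1 => t_ i
  | t_ 0 => s_0
  | _ => sink
  end.

Lemma climb_supp (s : state (ex_mdp R)) p :
  path (@edge R (ex_mdp R)) s p -> controlled (last s p) ->
  forall s', 0 < point_distr R (climb_next (s :: p) : state (ex_mdp R)) s' ->
  edge (last s p) s'.
Proof.
move=> _ + s' /point_distr_gt0 ->; rewrite /climb_next /=.
case: (last s p) => [|i|[|i]|i|]//= _.
by case: ifP => _ /=; rewrite eqxx.
Qed.

Definition climb : strategy (ex_mdp R) :=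
  @Strategy R (ex_mdp R) (fun w => point_distr R (climb_next w)) climb_supp.

Let half n : R := 2^-1 ^+ n.

Let half_ge0 n : 0 <= half n.
Proof. by rewrite exprn_ge0 ?invr_ge0. Qed.

Let halfS n : half n = half n.+1 + half n.+1.
Proof. by rewrite /half exprS; lra. Qed.

Let half_le m n : (m <= n)%N -> half n <= half m.
Proof. by move=> mn; rewrite ler_wiXn2l//; lra. Qed.

(* An upper bound for the probability of reaching the sink from history w:
   the climb following a history of level n reaches some rho_ i with n <= i,
   and the later ones have levels n.+1, n.+2, etc. *)
Definition risk (w : seq ex_state) : R :=
  if sink \in w then 1 else
  match last s_0 w with
  | s_0 | c_ _ => half (level w)
  | rho_ i => half i.+1 + half (level w).+1
  | t_ _ => half (level w).+1
  | sink => 1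
  end.

Lemma risk_ge0 w : 0 <= risk w.
Proof.
rewrite /risk; case: ifP => // _.
by case: (last _ _) => // *; rewrite addr_ge0.
Qed.

Lemma level_rcons w x : level (rcons w x) = (level w + (x == s_0))%N.
Proof. by rewrite /level -cats1 count_cat /= addn0 addnA. Qed.

(** Apart from the case where [sink] was already seen, the bound can drop in two places only. On
    entering [rho_ i] from [c_ i], [i] is at least the level, so [half (level w)] covers both halves
    [half i.+1] and [half (level w).+1]. At [rho_ i], the coin costs at most [half i.+1]. The step
    from [t_ 0] to [s_0] raises the level by one, which the exponent at [t_] anticipates. *)
Lemma risk_super w :
  (\esum_(x in [set: ex_state])
    (@strategy_kernel R (ex_mdp R) s_0 climb (s_0 :: w) x *
     risk (rcons (s_0 :: w) x))%:E <=
   (risk (s_0 :: w))%:E)%E.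
Proof.
set v := s_0 :: w; set f := fun x => risk (rcons v x).
have f0 x : 0 <= f x by exact: risk_ge0.
have [vs|nvs] := boolP (sink \in v).
  have f1 x : f x = 1 by rewrite /f /risk mem_rcons inE vs orbT.
  rewrite [in leRHS]/risk vs.
  have -> : 1%E = \esum_(x in [set: ex_state])
      (@strategy_kernel R (ex_mdp R) s_0 climb v x)%:E by rewrite mass_sum1.
  by apply: le_esum => x _; rewrite lee_fin -/(f x) f1 mulr1.
have fE x : f x = if x == sink then 1 else
  match x with
  | s_0 => half (level v).+1
  | c_ _ => half (level v)
  | rho_ i => half i.+1 + half (level v).+1
  | t_ _ => half (level v).+1
  | sink => 1
  end.
  rewrite /f /risk mem_rcons inE (negPf nvs) orbF eq_sym; case: ifP => //.
  by rewrite last_rcons level_rcons; case: x => [|i|i|i|];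
    rewrite ?addn0 ?addn1.
have pointE x : (\esum_(z in [set: ex_state]) (point_distr R x z * f z)%:E =
    (f x)%:E)%E.
  by rewrite esum_coin// subrr mul0r addr0 mul1r.
rewrite /strategy_kernel /risk (negPf nvs).
rewrite -/v; have : sink != last s_0 v.
  by apply: contraNneq nvs => ->; exact: (mem_last s_0 w).
have := halfS (level v).
case lv : (last s_0 v) => [|i|i|i|]//= hS _.
- by rewrite pointE /climb_next lv fE.
- rewrite pointE /climb_next lv fE lee_fin; case: ltnP => //= li.
  have := half_le li; have := half_ge0 i; rewrite (halfS i) hS; lra.
- rewrite pointE /climb_next lv fE lee_fin.
  by case: i lv => [|i] _ /=.
rewrite (esum_coin sink (t_ i) (half_pow01 R i.+1) f0) !fE /= lee_fin.
rewrite -/(half i.+1).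
by have := half_ge0 i.+1; have := half_ge0 (level v).+1; nra.
Qed.

Lemma climb_zero_reward (r : run s_0) : r 0%N = s_0 ->
  (forall n,
    0 < @strategy_kernel R (ex_mdp R) s_0 climb (mkseq r n.+1) (r n.+1)) ->
  (forall n, r n <> sink) ->
  forall n0, exists2 n, (n0 <= n)%N & ex_reward R (r n) (r n.+1) = 0.
Proof.
move=> r0 rk nsink n0; apply/not_exists2P => nex.
have lastr n : last s_0 (mkseq r n.+1) = r n by rewrite mkseqS last_rcons.
(* Away from [sink], the only steps of nonzero reward are those of the climb. *)
have step n : (n0 <= n)%N -> match r n with
    | s_0 => r n.+1 = c_ 0
    | c_ i => (i < level (mkseq r n.+1))%N /\ r n.+1 = c_ i.+1
    | _ => False end.
  move=> n0n; have [//|rn0] := nex n.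
  have := rk n; rewrite /strategy_kernel lastr.
  case rn : (r n) rn0 => [|i|i|i|]/= rn0.
  - by move=> /point_distr_gt0 ->; rewrite /climb_next lastr rn.
  - move=> /point_distr_gt0; rewrite /climb_next lastr rn.
    by case: ifP => // _ rn1; move: rn0; rewrite rn1.
  - by move: rn0; case: (r n.+1).
  - by have := nsink n.+1; case: (r n.+1) rn0.
  - by have := nsink n.
have [n1 [i [n01 rn1]]] : exists n1 i, (n0 <= n1)%N /\ r n1 = c_ i.
  have := step n0 (leqnn _); case rn : (r n0) => [|i|i|i|]// => [rn1|_].
    by exists n0.+1, 0%N.
  by exists n0, i.
have climbing d : r (n1 + d)%N = c_ (i + d) /\
    level (mkseq r (n1 + d).+1) = level (mkseq r n1.+1).
  elim: d => [|d [IH lv]]; first by rewrite !addn0.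
  have := step (n1 + d)%N (leq_trans n01 (leq_addr _ _)).
  rewrite IH => -[_ rS]; rewrite !addnS rS; split => //.
  by rewrite mkseqS level_rcons rS addn0.
set L := level (mkseq r n1.+1).
(* After [L] more steps the index is [i + L], no longer below the unchanged level [L], so the climb
   should have stopped. *)
have := step (n1 + L)%N (leq_trans n01 (leq_addr _ _)).
by have [-> ->] := climbing L; rewrite -/L ltnNge leq_addl => -[].
Qed.

(** Almost every run outside the event visits [sink], and the risk of the one-state history
    [[:: s_0]] is [half N.+1]. *)
Lemma climb_prob :
  ((1 - half N.+1)%:E <=
   strategy_prob (ex_mdp R) s_0 climb (limsup_reward_ge0 (ex_mdp R) s_0))%E.
Proof.
set E := limsup_reward_ge0 _ _; set P := strategy_prob _ _ _.
have mE : measurable E by exact: measurable_limsup_reward_ge0.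
have : (P (~` E) <= (risk [:: s_0])%:E)%E.
  refine (@supermartingale_le R (state (ex_mdp R)) s_0
    (@strategy_kernel R (ex_mdp R) s_0 climb) risk risk_ge0 risk_super
    [set w : seq ex_state | sink \in w] (~` E) _ _ _ _) => //.
  - by move=> w x; rewrite /= mem_rcons inE orbC => ->.
  - by move=> w /= sw; rewrite /risk sw.
  - exact: measurableC.
  move=> r r0 rk /= nE; apply/not_existsP => nsink; apply: nE.
  apply/limsup_reward_ge0P/climb_zero_reward => // n rn.
  by apply: (nsink n) => /=; rewrite -rn mkseqS mem_rcons inE eqxx.
rewrite probability_setC// /risk /= /level /= addn1.
rewrite -/(half _) EFinB => PE.
by rewrite leeBlDr// -leeBlDl// fin_num_measure.
Qed.

End Climb.

Theorem proposition20 (R : realType) :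
  ereal_sup [set strategy_prob (ex_mdp R) s_0 sigma
                   (limsup_reward_ge0 (ex_mdp R) s_0)
            | sigma in [set: strategy (ex_mdp R)]] = 1%E
  /\ (forall sigma : fm_strategy (ex_mdp R),
        fm_strategy_prob (ex_mdp R) s_0 sigma
          (limsup_reward_ge0 (ex_mdp R) s_0) = 0%E).
Proof.
split=> [|sigma]; last exact: fm_limsup_reward0.
apply/eqP; rewrite eq_le; apply/andP; split.
  apply: ub_ereal_sup => _ [sigma _ <-].
  by apply: probability_le1; exact: measurable_limsup_reward_ge0.
(* The supremum is approached by the strategies [climb R N] as [N] grows. *)
have cvg1 : (fun N => (1 - 2^-1 ^+ N.+1 : R)%:E) @ \oo --> 1%E.
  apply: cvg_EFin; first exact: nearW.
  rewrite -[X in _ --> X]subr0; apply: cvgB; first exact: cvg_cst.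
  rewrite (cvg_shiftS (fun n => 2^-1 ^+ n : R)); apply: cvg_expr.
  by rewrite ger0_norm; lra.
rewrite -(cvg_lim _ cvg1)//.
apply: lime_le; first by apply/cvg_ex; eexists; exact: cvg1.
apply: nearW => N; apply: le_trans (climb_prob R N) _.
by apply: ereal_sup_ubound; exists (climb R N).
Qed.
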